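(* Let $M$ be an orientable surface in $E^3$, let $\alpha:[0,l]\times[0,w)\to M\subset E^3$, $(u,t)\mapsto\alpha(u,t)$, be a one-parameter family of differentiable curves on $M$ with speed $v=\left\|\frac{\partial\alpha}{\partial u}\right\|>0$, let $\{T,g,n\}$ be the Darboux frame of $\alpha$ on $M$, and let $\frac{\partial\alpha}{\partial t}=f_1T+f_2g+f_3n$ be a differentiable flow of $\alpha$, with scalar functions $f_1,f_2,f_3$ of $(u,t)$. (i) If $\alpha$ is a geodesic curve on $M$, then the curve flow is inextensible if and only if $\frac{\partial f_1}{\partial s}=f_3k_n$. (ii) If $\alpha$ is an asymptotic line on $M$, then the curve flow is inextensible if and only if $\frac{\partial f_1}{\partial s}=f_2k_g$.
   Context: $M$ is oriented by a unit normal field. For each fixed $t$, the curve $u\mapsto\alpha(u,t)$ lies on $M$; ''differentiable'' means differentiable enough that all derivatives involved exist and mixed partial derivatives commute. $\frac{\partial}{\partial s}=\frac1v\frac{\partial}{\partial u}$ denotes the derivative with respect to arclength along the curve at fixed $t$. The Darboux frame $\{T,g,n\}$ along the curve: $T=\frac{\partial\alpha}{\partial s}$ is the unit tangent, $n$ is the unit normal of $M$ along the curve, $g=n\times T$. The geodesic curvature $k_g$, normal curvature $k_n$ and geodesic torsion $\tau_g$ are defined by $$\frac{\partial T}{\partial s}=k_gg+k_nn,\quad \frac{\partial g}{\partial s}=-k_gT+\tau_gn,\quad \frac{\partial n}{\partial s}=-k_nT-\tau_gg.$$ The curve evolution $\alpha$ and its flow $\frac{\partial\alpha}{\partial t}$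 are called inextensible if $\frac{\partial}{\partial t}\left\|\frac{\partial\alpha}{\partial u}\right\|=0$ for all $(u,t)$. The curve $\alpha$ is a geodesic if and only if $k_g=0$ and an asymptotic line if and only if $k_n=0$ (identically in $(u,t)$). *)

(* Defs.v *)
From HB Require Import structures.
From mathcomp Require Import all_boot all_order all_algebra.
From mathcomp Require Import all_classical all_reals all_analysis.

Set Implicit Arguments.
Unset Strict Implicit.
Unset Printing Implicit Defensive.

Import Order.TTheory GRing.Theory Num.Theory.
Import numFieldNormedType.Exports.
Local Open Scope classical_set_scope.
Local Open Scope ring_scope.

(* The library's norm on 'rV[R]_3 is the sup norm (it gives the right topology
   and derivatives); the Euclidean structure of E^3 is therefore defined here. *)
Definition dot (R : realType) (a b : 'rV[R]_3) : R :=
  \sum_(i < 3) a ord0 i * b ord0 i.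

Definition enorm (R : realType) (a : 'rV[R]_3) : R := Num.sqrt (dot a a).

(* Index arithmetic is modulo 3. *)
Definition cross (R : realType) (a b : 'rV[R]_3) : 'rV[R]_3 :=
  \row_(k < 3) (a ord0 (k + 1) * b ord0 (k + 2%:R)
                - a ord0 (k + 2%:R) * b ord0 (k + 1)).

(* C^k on U: a map is C^(k+1) iff it is (Frechet) differentiable on U and all
   its directional derivatives q |-> df_q(h) are C^k. *)
Fixpoint Ck (R : realType) (k : nat) (U : set 'rV[R]_2)
    (f : 'rV[R]_2 -> 'rV[R]_3) : Prop :=
  match k with
  | 0%N => forall q, U q -> {for q, continuous f}
  | k'.+1 => (forall q, U q -> differentiable f q) /\
             (forall h : 'rV[R]_2, Ck k' U (fun q => 'd f q h))
  end.

(* x : U -> V `&` M is a regular local parametrization of M: U and V are open,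
   x is C^2 with injective differential, and it is a homeomorphism of U onto
   V `&` M. *)
Definition local_param (R : realType) (M V : set 'rV[R]_3) (U : set 'rV[R]_2)
    (x : 'rV[R]_2 -> 'rV[R]_3) : Prop :=
  [/\ open U, open V, x @` U = V `&` M, Ck 2 U x &
      (forall q, U q -> injective ('d x q)) /\
      (exists2 y : 'rV[R]_3 -> 'rV[R]_2,
         (forall q, U q -> y (x q) = q) & {within V `&` M, continuous y})].

Definition regular_surface (R : realType) (M : set 'rV[R]_3) : Prop :=
  forall p, M p -> exists V U x, local_param M V U x /\ V p.

(* The tangent plane T_pM is the image of the differential of a local
   parametrization. *)
Definition tangent_vector (R : realType) (M : set 'rV[R]_3) (p a : 'rV[R]_3)
    : Prop :=
  exists V U x q h,
    [/\ local_param M V U x, U q, x q = p & a = 'd x q h].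

Definition unit_normal_field (R : realType) (M : set 'rV[R]_3)
    (N : 'rV[R]_3 -> 'rV[R]_3) : Prop :=
  [/\ {within M, continuous N},
      forall p, M p -> enorm (N p) = 1 &
      forall p a, M p -> tangent_vector M p a -> dot (N p) a = 0].

(* Derivative at a of a function defined on D only: the limit is taken along
   points of D, so it is one-sided at an endpoint of an interval D. *)
Definition diff_quotient (R : realType) (W : normedModType R) (f : R -> W)
    (a y : R) : W := (y - a)^-1 *: (f y - f a).

Definition derivable_in (R : realType) (W : normedModType R) (D : set R)
    (f : R -> W) (a : R) : Prop :=
  cvg (diff_quotient f a y @[y --> within D (a^')]).

Definition derive_in (R : realType) (W : normedModType R) (D : set R)
    (f : R -> W) (a : R) : W :=
  lim (diff_quotient f a y @[y --> within D (a^')]).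

(* Partial derivatives of a function F u t on [0, l] x [0, w). *)
Definition derivable_u (R : realType) (W : normedModType R) (l : R)
    (F : R -> R -> W) (u t : R) : Prop :=
  derivable_in `[0, l] (fun y => F y t) u.

Definition derivable_t (R : realType) (W : normedModType R) (w : R)
    (F : R -> R -> W) (u t : R) : Prop :=
  derivable_in `[0, w[ (F u) t.

Definition partial_u (R : realType) (W : normedModType R) (l : R)
    (F : R -> R -> W) (u t : R) : W :=
  derive_in `[0, l] (fun y => F y t) u.

Definition partial_t (R : realType) (W : normedModType R) (w : R)
    (F : R -> R -> W) (u t : R) : W :=
  derive_in `[0, w[ (F u) t.

Definition on_domain (R : realType) (l w : R) (P : R -> R -> Prop) : Prop :=
  forall u t, u \in `[0, l] -> t \in `[0, w[ -> P u t.

Definition speed (R : realType) (l : R) (alpha : R -> R -> 'rV[R]_3)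
    (u t : R) : R := enorm (partial_u l alpha u t).

Definition partial_s (R : realType) (W : normedModType R) (l : R)
    (alpha : R -> R -> 'rV[R]_3) (F : R -> R -> W) (u t : R) : W :=
  (speed l alpha u t)^-1 *: partial_u l F u t.

Definition frameT (R : realType) (l : R) (alpha : R -> R -> 'rV[R]_3)
    : R -> R -> 'rV[R]_3 := partial_s l alpha alpha.

Definition framen (R : realType) (N : 'rV[R]_3 -> 'rV[R]_3)
    (alpha : R -> R -> 'rV[R]_3) (u t : R) : 'rV[R]_3 := N (alpha u t).

Definition frameg (R : realType) (l : R) (N : 'rV[R]_3 -> 'rV[R]_3)
    (alpha : R -> R -> 'rV[R]_3) (u t : R) : 'rV[R]_3 :=
  cross (framen N alpha u t) (frameT l alpha u t).

(* "Differentiable enough": the derivatives of alpha and n occurring in the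
   evolution and in the Darboux equations exist, and the mixed partial
   derivatives of alpha commute.  Derivability of T, g and of the speed
   follows when the speed is positive. *)
Definition differentiable_family (R : realType) (l w : R)
    (N : 'rV[R]_3 -> 'rV[R]_3) (alpha : R -> R -> 'rV[R]_3) : Prop :=
  on_domain l w (fun u t =>
    [/\ derivable_u l alpha u t /\ derivable_t w alpha u t,
        derivable_u l (partial_u l alpha) u t,
        derivable_t w (partial_u l alpha) u t /\
        derivable_u l (partial_t w alpha) u t,
        partial_t w (partial_u l alpha) u t
          = partial_u l (partial_t w alpha) u t &
        derivable_u l (framen N alpha) u t]).

Definition differentiable_flow (R : realType) (l w : R)
    (N : 'rV[R]_3 -> 'rV[R]_3) (alpha : R -> R -> 'rV[R]_3)
    (f1 f2 f3 : R -> R -> R) : Prop :=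
  on_domain l w (fun u t =>
    [/\ derivable_u l (f1 : R -> R -> R^o) u t,
        derivable_u l (f2 : R -> R -> R^o) u t,
        derivable_u l (f3 : R -> R -> R^o) u t &
        partial_t w alpha u t = f1 u t *: frameT l alpha u t
                                + f2 u t *: frameg l N alpha u t
                                + f3 u t *: framen N alpha u t]).

Definition darboux_curvatures (R : realType) (l w : R)
    (N : 'rV[R]_3 -> 'rV[R]_3) (alpha : R -> R -> 'rV[R]_3)
    (kg kn tg : R -> R -> R) : Prop :=
  let T := frameT l alpha in
  let g := frameg l N alpha in
  let n := framen N alpha in
  on_domain l w (fun u t =>
    [/\ partial_s l alpha T u t = kg u t *: g u t + kn u t *: n u t,
        partial_s l alpha g u t = - kg u t *: T u t + tg u t *: n u t &
        partial_s l alpha n u t = - kn u t *: T u t - tg u t *: g u t]).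

Definition inextensible (R : realType) (l w : R) (alpha : R -> R -> 'rV[R]_3)
    : Prop :=
  on_domain l w (fun u t =>
    partial_t w (speed l alpha : R -> R -> R^o) u t = 0).

Definition geodesic (R : realType) (l w : R) (kg : R -> R -> R) : Prop :=
  on_domain l w (fun u t => kg u t = 0).

Definition asymptotic_line (R : realType) (l w : R) (kn : R -> R -> R) : Prop :=
  on_domain l w (fun u t => kn u t = 0).

(* Main.v *)
(* Along each curve, <alpha_t, T> = f1.  Differentiating in s and using the
   Darboux equation for T, <(alpha_t)_s, T> = (f1)_s - f2 k_g - f3 k_n, while
   commuting the partial derivatives gives v_t = <alpha_tu, T> =
   v <(alpha_t)_s, T>.  Hence v_t = v ((f1)_s - f2 k_g - f3 k_n). *)
Require Import Defs.
From HB Require Import structures.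
From mathcomp Require Import all_boot all_order all_algebra.
From mathcomp Require Import all_classical all_reals all_analysis.
From mathcomp Require Import ring lra.

Import Order.TTheory GRing.Theory Num.Theory.
Import numFieldNormedType.Exports.
Local Open Scope classical_set_scope.
Local Open Scope ring_scope.

Set Implicit Arguments.
Unset Strict Implicit.
Unset Printing Implicit Defensive.

(** * Sup-norm estimates for matrices and injective linear maps *)

Section matrix_norm.
Context {R : realType}.

Lemma mx_coord_norm_le m n (A : 'M[R]_(m, n)) i j : `|A i j| <= `|A|.
Proof.
rewrite [leRHS]/Num.norm/= mx_normrE.
by apply/bigmax_geP; right; exists (i, j).
Qed.

Lemma mulmx_norm_le m n p (A : 'M[R]_(m, n)) (B : 'M[R]_(n, p)) :
  `|A *m B| <= n%:R * `|A| * `|B|.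
Proof.
rewrite [leLHS]/Num.norm/= mx_normrE.
apply/bigmax_leP; split=> [|[i j] _ /=]; first by rewrite !mulr_ge0.
rewrite mxE (le_trans (ler_norm_sum _ _ _))//.
rewrite (le_trans (ler_sum _ (G := fun=> `|A| * `|B|) _))//.
  by move=> k _; rewrite normrM ler_pM// mx_coord_norm_le.
by rewrite sumr_const card_ord -mulrA mulr_natl.
Qed.

(** Injectivity makes the matrix of [f] row free, so multiplying by its pseudo-inverse recovers [h]
    from [f h], and the norm of the pseudo-inverse controls [K]. *)
Lemma injective_linear_expanding m n (f : {linear 'rV[R]_m -> 'rV[R]_n}) :
  injective f -> exists2 K, 0 < K & forall h, `|h| <= K * `|f h|.
Proof.
move=> injf; pose A := lin1_mx f.
have freeA : row_free A.
  apply: inj_row_free => v; rewrite mul_rV_lin1 => fv0.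
  by apply: injf; rewrite fv0 linear0.
(* Adding 1 keeps the constant positive even if the first term vanishes. *)
exists (n%:R * `|pinvmx A| + 1) => [|h]; first by rewrite ltr_wpDl// mulr_ge0.
rewrite -[h in leLHS](mulmxKp freeA) mul_rV_lin1 (le_trans (mulmx_norm_le _ _))//.
by rewrite mulrAC ler_wpM2r// lerDl.
Qed.

End matrix_norm.

(** * Algebra and continuity of the Euclidean product and the cross product *)

Section dot_product.
Context {R : realType}.
Implicit Types (a b c : 'rV[R]_3) (k : R).

Lemma dotC a b : dot a b = dot b a.
Proof. by apply: eq_bigr => i _; rewrite mulrC. Qed.

Lemma dotDl a b c : dot (a + b) c = dot a c + dot b c.
Proof. by rewrite -big_split; apply: eq_bigr => i _; rewrite mxE mulrDl. Qed.

Lemma dotZl k a b : dot (k *: a) b = k * dot a b.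
Proof. by rewrite mulr_sumr; apply: eq_bigr => i _; rewrite mxE mulrA. Qed.

Lemma dotBl a b c : dot (a - b) c = dot a c - dot b c.
Proof. by rewrite dotDl -scaleN1r dotZl mulN1r. Qed.

Lemma dotDr a b c : dot a (b + c) = dot a b + dot a c.
Proof. by rewrite !(dotC a) dotDl. Qed.

Lemma dotZr k a b : dot a (k *: b) = k * dot a b.
Proof. by rewrite !(dotC a) dotZl. Qed.

Lemma dotBr a b c : dot a (b - c) = dot a b - dot a c.
Proof. by rewrite !(dotC a) dotBl. Qed.

Lemma dot_ge0 a : 0 <= dot a a.
Proof. by apply: sumr_ge0 => i _; rewrite -expr2 sqr_ge0. Qed.

Lemma enorm_sqr a : enorm a ^+ 2 = dot a a.
Proof. by rewrite sqr_sqrtr// dot_ge0. Qed.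

(** A substitute for Cauchy-Schwarz in the sup norm; the factor 3 counts the coordinates. *)
Lemma dot_norm_le a b : `|dot a b| <= `|a| * `|b| *+ 3.
Proof.
rewrite (le_trans (ler_norm_sum _ _ _))//.
rewrite (le_trans (ler_sum _ (G := fun=> `|a| * `|b|) _))//.
  by move=> i _; rewrite normrM ler_pM// mx_coord_norm_le.
by rewrite sumr_const card_ord.
Qed.

(** These sums modulo 3 normalise the indices in [cross], so that vector identities become
    polynomial identities for [ring]. *)
Lemma addI3 : [/\ (2%:R + 1 : 'I_3) = 0, (2%:R + 2%:R : 'I_3) = 1,
  (1 + 2%:R : 'I_3) = 0 & (1 + 1 : 'I_3) = 2%:R].
Proof. by split; apply: val_inj. Qed.

Lemma crossE a b (k : 'I_3) : cross a b ord0 k =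
  a ord0 (k + 1) * b ord0 (k + 2%:R) - a ord0 (k + 2%:R) * b ord0 (k + 1).
Proof. by rewrite mxE. Qed.

Lemma dotE a b : dot a b = a ord0 0 * b ord0 0 + a ord0 1 * b ord0 1
  + a ord0 2%:R * b ord0 2%:R.
Proof.
rewrite /dot !big_ord_recl big_ord0 addr0 addrA.
by congr (_ * _ + _ * _ + _ * _); congr (_ _ _); apply: val_inj.
Qed.

Lemma dot_cross_l a b : dot (cross a b) a = 0.
Proof.
have [e21 e22 e12 e11] := addI3.
by rewrite !dotE !crossE e21 e22 e12 e11 !add0r; ring.
Qed.

Lemma dot_cross_r a b : dot (cross a b) b = 0.
Proof.
have [e21 e22 e12 e11] := addI3.
by rewrite !dotE !crossE e21 e22 e12 e11 !add0r; ring.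
Qed.

(** Lagrange's identity, from which $g$ inherits unit length. *)
Lemma dot_cross_cross a b : dot (cross a b) (cross a b) =
  dot a a * dot b b - dot a b ^+ 2.
Proof.
have [e21 e22 e12 e11] := addI3.
by rewrite !dotE !crossE e21 e22 e12 e11 !add0r; ring.
Qed.

Lemma cvg_dot {T : Type} {F : set_system T} {FF : Filter F}
    (f g : T -> 'rV[R]_3) a b :
  f x @[x --> F] --> a -> g x @[x --> F] --> b ->
  dot (f x) (g x) @[x --> F] --> dot a b.
Proof.
move=> fa gb; rewrite dotE; under eq_fun do rewrite dotE.
have cvg_coord (h : T -> 'rV[R]_3) c i : h x @[x --> F] --> c ->
    h x ord0 i @[x --> F] --> c ord0 i.
  move=> hc; apply: (@continuous_cvg _ _ _ F _ h (fun M : 'rV[R]_3 => M ord0 i) c) hc.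
  exact: coord_continuous.
by apply: cvgD; [apply: cvgD|]; apply: cvgM; exact: cvg_coord.
Qed.

End dot_product.

(** * Differential calculus relative to a domain, endpoints included *)

Section derivative_in.
Context {R : realType} (D : set R) (a : R).

(** The limit value is an explicit argument, so the calculus rules compose without uniqueness of
    limits; a proper filter is needed only to return to [derive_in]. *)
Definition has_derive_in {W : normedModType R} (f : R -> W) (L : W) : Prop :=
  diff_quotient f a y @[y --> within D a^'] --> L.

(** A second point [b] of the interval suffices: points on the segment from [a] towards [b] stay in
    [D] and approach [a]. This makes limits unique, also at an endpoint. *)
Lemma within_dnbhs_proper (b : R) : is_interval D -> D a -> D b -> b != a ->
  ProperFilter (within D a^').
Proof.
move=> Di Da Db ba; apply: Build_ProperFilter_ex => P.
rewrite /within/= /dnbhs /within/= => /nbhs_ballP[e /= e0 He].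
have d0 : 0 < `|b - a| by rewrite normr_gt0 subr_eq0.
(* The bound 1 keeps the point between [a] and [b]; the other one puts it within [e / 2] of [a]. *)
pose s := Num.min 1 (e / (2 * `|b - a|)).
have s0 : 0 < s by rewrite lt_min ltr01 divr_gt0// mulr_gt0.
have s1 : s <= 1 by rewrite ge_min lexx.
have se : s * `|b - a| < e.
  apply: (@le_lt_trans _ _ (e / 2)).
    have : s <= e / (2 * `|b - a|) by rewrite ge_min lexx orbT.
    move=> /(ler_wpM2r (ltW d0)) /le_trans; apply.
    by rewrite invfM mulrA mulfVK// gt_eqF.
  by rewrite /= in e0; lra.
exists (a + s * (b - a)); apply: He.
- by rewrite /ball/= opprD addrA subrr sub0r normrN normrM gtr0_norm.
- by rewrite -subr_eq0 addrAC subrr add0r mulf_neq0 ?subr_eq0// gt_eqF.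
- have [ab|ab] := leP a b.
    by apply: (Di _ _ Da Db); apply/andP; split; nra.
  by apply: (Di _ _ Db Da); apply/andP; split; nra.
Qed.

Lemma near_within_dnbhs (P : R -> Prop) :
  (forall y, D y -> y != a -> P y) -> \forall y \near within D a^', P y.
Proof.
move=> DP; apply: (@filterS _ (nbhs a) _ setT); last exact: filterT.
by move=> y _ ya Dy; exact: DP.
Qed.

Lemma cvg_within_dnbhs : y @[y --> within D a^'] --> a.
Proof.
by move=> P; apply: (@filterS _ (nbhs a)) => y. Qed.

(** Differentiability gives continuity, since [f y] is [f a] plus [y - a] times the difference
    quotient. *)
Lemma has_derive_in_cvg {W : normedModType R} (f : R -> W) (L : W) :
  has_derive_in f L -> f y @[y --> within D a^'] --> f a.
Proof.
move=> fL.
have : (y - a) *: diff_quotient f a y + f a @[y --> within D a^']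
    --> (a - a) *: L + f a.
  apply: cvgD; last exact: cvg_cst.
  by apply: cvgZ fL; apply: cvgB; [exact: cvg_within_dnbhs|exact: cvg_cst].
rewrite subrr scale0r add0r; apply: cvg_trans; apply: near_eq_cvg.
apply: near_within_dnbhs => y _ ya.
by rewrite /diff_quotient scalerA divff ?subr_eq0// scale1r subrK.
Qed.

Lemma derivable_inP {W : normedModType R} (f : R -> W) :
  derivable_in D f a -> has_derive_in f (derive_in D f a).
Proof. by []. Qed.

Lemma has_derive_in_val {W : normedModType R} {FF : ProperFilter (within D a^')}
  (f : R -> W) L : has_derive_in f L -> derive_in D f a = L.
Proof. by move=> fL; apply/cvg_lim. Qed.

Lemma eq_has_derive_in {W : normedModType R} (f g : R -> W) L :
  (forall y, D y -> f y = g y) -> D a -> has_derive_in f L -> has_derive_in g L.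
Proof.
move=> fg Da; apply: cvg_trans; apply: near_eq_cvg.
by apply: near_within_dnbhs => y Dy _; rewrite /diff_quotient !fg.
Qed.

Lemma has_derive_in_dot (f g : R -> 'rV[R]_3) f' g' :
  has_derive_in f f' -> has_derive_in g g' ->
  has_derive_in (fun y => dot (f y) (g y) : R^o)
    (dot f' (g a) + dot (f a) g').
Proof.
move=> df dg.
have : dot (diff_quotient f a y) (g y)
     + dot (f a) (diff_quotient g a y) @[y --> within D a^']
    --> dot f' (g a) + dot (f a) g'.
  by apply: cvgD; apply: cvg_dot => //; [exact: has_derive_in_cvg dg|exact: cvg_cst].
apply: cvg_trans; apply: near_eq_cvg; apply: near_within_dnbhs => y _ _.
by rewrite /diff_quotient dotZl dotZr -mulrDr dotBl dotBr addrA subrK.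
Qed.

Lemma has_derive_in_scale {W : normedModType R} (k : R -> R) (f : R -> W) k' f' :
  has_derive_in (k : R -> R^o) k' -> has_derive_in f f' ->
  has_derive_in (fun y => k y *: f y) (k' *: f a + k a *: f').
Proof.
move=> dk df.
have : (diff_quotient (W := R^o) k a y : R) *: f y
     + k a *: diff_quotient f a y @[y --> within D a^']
    --> k' *: f a + k a *: f'.
  by apply: cvgD; apply: cvgZ => //; [exact: has_derive_in_cvg df|exact: cvg_cst].
apply: cvg_trans; apply: near_eq_cvg; apply: near_within_dnbhs => y _ _.
rewrite /diff_quotient scalerA mulrC -!scalerA -scalerDr; congr (_ *: _).
by rewrite scalerBl scalerBr addrA subrK.
Qed.

Lemma has_derive_in_inv (f : R -> R) f' : (forall y, D y -> f y != 0) -> D a ->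
  has_derive_in (f : R -> R^o) f' ->
  has_derive_in (fun y => (f y)^-1 : R^o) (- f' / f a ^+ 2).
Proof.
move=> f0 Da df.
have : - (diff_quotient (W := R^o) f a y : R) * ((f y)^-1 * (f a)^-1)
    @[y --> within D a^'] --> - f' * ((f a)^-1 * (f a)^-1).
  apply: cvgM; first exact: cvgN.
  apply: cvgM; last exact: cvg_cst.
  by apply: cvgV; [exact: f0|exact: (has_derive_in_cvg df)].
rewrite -invfM -expr2; apply: cvg_trans; apply: near_eq_cvg.
apply: near_within_dnbhs => y Dy ya; rewrite /diff_quotient /GRing.scale/=.
by field; rewrite !f0// subr_eq0 ya.
Qed.

(** The difference of two square roots is rationalised: the quotient of the squared norm is divided
    by the sum of the two norms. *)
Lemma has_derive_in_enorm (f : R -> 'rV[R]_3) f' : 0 < enorm (f a) ->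
  has_derive_in f f' ->
  has_derive_in (fun y => enorm (f y) : R^o) (dot f' (f a) / enorm (f a)).
Proof.
move=> fa0 df.
have cf : enorm (f y) @[y --> within D a^'] --> enorm (f a).
  apply: (@continuous_cvg _ _ _ _ _ (fun y => dot (f y) (f y)) Num.sqrt).
    exact: sqrt_continuous.
  by apply: cvg_dot; exact: has_derive_in_cvg df.
have : (diff_quotient (W := R^o) (fun y => dot (f y) (f y)) a y : R)
    / (enorm (f y) + enorm (f a)) @[y --> within D a^']
    --> (dot f' (f a) + dot (f a) f') / (enorm (f a) + enorm (f a)).
  apply: cvgM; first exact: has_derive_in_dot.
  by apply: cvgV; [rewrite gt_eqF// addr_gt0|apply: cvgD => //; exact: cvg_cst].
have -> : (dot f' (f a) + dot (f a) f') / (enorm (f a) + enorm (f a)) =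
    dot f' (f a) / enorm (f a).
  by rewrite (dotC (f a)) -!mulr2n -mulr_natl -[in X in _ / X]mulr_natl -mulf_div
    divff ?mul1r// pnatr_eq0.
apply: cvg_trans; apply: near_eq_cvg; apply: near_within_dnbhs => y Dy ya.
rewrite /diff_quotient /GRing.scale/= -!enorm_sqr.
(* Only [enorm (f a)] is known to be positive; [enorm (f y)] may vanish. *)
have s0 : enorm (f y) + enorm (f a) != 0.
  by rewrite gt_eqF// ltr_wpDl// sqrtr_ge0.
by field; rewrite s0 subr_eq0 ya.
Qed.

End derivative_in.

(** * Velocities of curves on a surface are orthogonal to its normals *)

Section tangency.
Context {R : realType}.

(* Write c y = x (q0 + h y), with q0 + h y = g (c y) only known to tend to q0.
   As 'd x q0 is bounded below, c y - c a = 'd x q0 (h y) + o(h y) gives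
   h y = O(c y - c a); hence nu sees only the remainder o(c y - c a), and no
   inverse function theorem is needed to differentiate h. *)
Lemma velocity_normal0 (D : set R) (a : R) {FF : ProperFilter (within D a^')}
    (M : set 'rV[R]_3) (c : R -> 'rV[R]_3) (nu c' : 'rV[R]_3) :
  regular_surface M -> D a -> (forall y, D y -> M (c y)) ->
  (forall v, tangent_vector M (c a) v -> dot nu v = 0) ->
  has_derive_in D a c c' -> dot nu c' = 0.
Proof.
move=> surfM Da cM nu0 dc.
have [V [U [x [lp Vca]]]] := surfM _ (cM _ Da).
have [oU oV xU [dx _] [injdx [g gK cg]]] := lp.
have : (V `&` M) (c a) by split => //; exact: cM.
rewrite -xU => -[q0 Uq0 xq0].
have gca : g (c a) = q0 by rewrite -xq0 gK.
pose h y := g (c y) - q0.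
have cc := has_derive_in_cvg dc.
have nearV : \forall y \near within D a^', (V `&` M) (c y).
  near=> y; split; last by apply: cM; near: y; exact: withinT.
  by near: y; apply: cc; exact: open_nbhs_nbhs.
(* [g] is continuous only relative to [V] and [M], so composing it with [c] relies on [nearV]. *)
have hc : h y @[y --> within D a^'] --> (0 : 'rV[R]_2).
  rewrite -(subrr q0); apply: cvgB; last exact: cvg_cst.
  rewrite -[X in _ --> X]gca.
  have /subspace_continuousP/(_ (c a)) := cg.
  have VMca : (V `&` M) (c a) by split => //; exact: cM.
  move=> /(_ VMca) gc P /gc Pg.
  have := cc _ Pg.
  rewrite nbhs_simpl /= => Pc.
  by move: nearV Pc; apply: filterS2 => y VMy; apply.
have [K K0 hK] := injective_linear_expanding (injdx _ Uq0).
have lim0 : dot nu (diff_quotient c a y) @[y --> within D a^'] --> (0 : R^o).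
  apply/cvgr0Pnorm_le => e e0.
  pose B := `|c'| + 1; pose n1 := `|nu| + 1.
  have B0 : 0 < B by rewrite ltr_wpDl.
  have n10 : 0 < n1 by rewrite ltr_wpDl.
  (* The first bound allows the remainder to be absorbed into [h y]. In the second, 6 is the 3 of
     [dot_norm_le] times the 2 of [hdelta], while [n1] and [B] bound [nu] and the difference
     quotients. *)
  pose eps := Num.min (1 / (2 * K)) (e / (6 * K * n1 * B)).
  have eps0 : 0 < eps by rewrite lt_min !divr_gt0// !mulr_gt0.
  have epsK : K * eps <= 1 / 2.
    have : eps <= 1 / (2 * K) by rewrite ge_min lexx.
    by rewrite ler_pdivlMr ?mulr_gt0// => ?; lra.
  have epse : eps * (6 * K * n1 * B) <= e.
    have : eps <= e / (6 * K * n1 * B) by rewrite ge_min lexx orbT.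
    by rewrite ler_pdivlMr// !mulr_gt0.
  have rem : \forall k \near (0 : 'rV[R]_2),
      `|x (k + q0) - x q0 - 'd x q0 k| <= eps * `|k|.
    have xE := diff_locallyx (dx _ Uq0).
    near=> k; rewrite xE -[X in X - _ - _]addrA [X in X - _ - _]addrC addrK.
    rewrite addrAC subrr add0r.
    near: k; exact: littleoP.
  have dqB : \forall y \near within D a^', `|diff_quotient c a y| <= B.
    by apply: (cvgr_le `|c'| (cvg_norm dc)); rewrite ltrDl.
  have remh := hc _ rem.
  near=> y.
  have [q Uq xq] : (x @` U) (c y) by rewrite xU; near: y; exact: nearV.
  have hyq : h y = q - q0 by rewrite /h -xq gK.
  have : `|c y - c a - 'd x q0 (h y)| <= eps * `|h y|.
    rewrite -xq0 -xq -[q](subrK q0) -hyq.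
    by near: y; exact: remh.
  set delta := c y - c a; set r := _ - 'd x q0 (h y) => rh.
  (* Absorption: $|h| \le K(|\delta| + |r|) \le K|\delta| + |h|/2$, because $K\,eps \le 1/2$. *)
  have hdelta : `|h y| <= 2 * K * `|delta|.
    have : `|'d x q0 (h y)| <= `|delta| + `|r|.
      by rewrite -[X in `|X|](subKr delta) ler_normB.
    have := hK (h y); have := normr_ge0 (h y); have := normr_ge0 r; nra.
  (* ['d x q0 (h y)] is a tangent vector, so [nu] annihilates it and only the remainder survives. *)
  have dotdelta : dot nu delta = dot nu r.
    rewrite [RHS]dotBr (nu0 ('d x q0 (h y))) ?subr0//.
    by exists V, U, x, q0, (h y); split.
  have dq_le : `|dot nu (diff_quotient c a y)| <=
      eps * (6 * K * `|nu|) * `|diff_quotient c a y|.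
    rewrite /diff_quotient dotZr dotdelta normrM normrZ -/delta.
    rewrite mulrCA ler_wpM2l// (le_trans (dot_norm_le _ _))//.
    have := ler_wpM2l (normr_ge0 nu) (le_trans rh (ler_wpM2l (ltW eps0) hdelta)).
    by rewrite -mulr_natl => ?; lra.
  rewrite (le_trans dq_le)// (le_trans _ epse)//.
  rewrite -!mulrA ler_wpM2l ?(ltW eps0)// !mulrA ler_pM// ?mulr_ge0// ?(ltW K0)//.
    by rewrite ler_wpM2l ?mulr_ge0 ?(ltW K0)// lerDl.
  by near: y; exact: dqB.
have limc : dot nu (diff_quotient c a y) @[y --> within D a^'] --> (dot nu c' : R^o).
  by apply: cvg_dot => //; exact: cvg_cst.
exact: (cvg_unique _ limc lim0).
Unshelve. all: by end_near. Qed.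

End tangency.

(** * Orthonormality of the Darboux frame and evolution of the speed *)

Section darboux.
Context {R : realType}.
Variables (M : set 'rV[R]_3) (N : 'rV[R]_3 -> 'rV[R]_3).
Variables (l w : R) (alpha : R -> R -> 'rV[R]_3).
Variables (f1 f2 f3 kg kn tg : R -> R -> R).
Hypotheses (l_gt0 : 0 < l) (w_gt0 : 0 < w) (surfM : regular_surface M).
Hypothesis orientM : unit_normal_field M N.
Hypothesis alphaM : on_domain l w (fun u t => M (alpha u t)).
Hypothesis diff_alpha : differentiable_family l w N alpha.
Hypothesis speed_gt0 : on_domain l w (fun u t => 0 < speed l alpha u t).
Hypothesis curv : darboux_curvatures l w N alpha kg kn tg.
Hypothesis flow : differentiable_flow l w N alpha f1 f2 f3.

Lemma within_itvcc_proper u : u \in `[0, l] ->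
  ProperFilter (within `[0, l] u^').
Proof.
move=> ul.
have i0 : `[0, l]%classic (0 : R) by rewrite /= in_itv/= lexx ltW.
have il : `[0, l]%classic (l : R) by rewrite /= in_itv/= lexx ltW.
have [u0|u0] := eqVneq u 0.
  by apply: (within_dnbhs_proper (b := l)) => //;
    [exact: interval_is_interval|rewrite u0 gt_eqF].
by apply: (within_dnbhs_proper (b := 0)) => //;
  [exact: interval_is_interval|rewrite eq_sym].
Qed.

Lemma within_itvco_proper t : t \in `[0, w[ ->
  ProperFilter (within `[0, w[ t^').
Proof.
move=> tw.
have i0 : `[0, w[%classic (0 : R) by rewrite /= in_itv/= lexx.
(* The endpoint [w] is excluded, so the midpoint serves as second point when [t] is 0. *)
have ih : `[0, w[%classic (w / 2 : R).
  by rewrite /= in_itv/= divr_ge0 ?ltW//= ltr_pdivrMr// ltr_pMr// ltr1n.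
have [t0|t0] := eqVneq t 0.
  by apply: (within_dnbhs_proper (b := w / 2)) => //;
    [exact: interval_is_interval|rewrite t0 gt_eqF// divr_gt0].
by apply: (within_dnbhs_proper (b := 0)) => //;
  [exact: interval_is_interval|rewrite eq_sym].
Qed.

Lemma frameT_unit u t : u \in `[0, l] -> t \in `[0, w[ ->
  dot (frameT l alpha u t) (frameT l alpha u t) = 1.
Proof.
move=> ul tw; have v0 := speed_gt0 ul tw.
(* [dotZl] and [dotZr] see through [frameT], which unfolds to the velocity scaled by the inverse
   speed. *)
rewrite dotZl dotZr -enorm_sqr -/(speed l alpha u t).
by field; rewrite gt_eqF.
Qed.

Lemma framen_unit u t : u \in `[0, l] -> t \in `[0, w[ ->
  dot (framen N alpha u t) (framen N alpha u t) = 1.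
Proof.
move=> ul tw; have [_ N1 _] := orientM.
by rewrite -enorm_sqr N1 ?expr1n//; exact: alphaM.
Qed.

(** $T$ is a multiple of the velocity, which [velocity_normal0] shows to be orthogonal to the
    normal. *)
Lemma framen_frameT u t : u \in `[0, l] -> t \in `[0, w[ ->
  dot (framen N alpha u t) (frameT l alpha u t) = 0.
Proof.
move=> ul tw; have [_ _ N0] := orientM; rewrite dotZr.
have pF := within_itvcc_proper ul.
have [[du _] _ _ _ _] := diff_alpha ul tw.
rewrite (velocity_normal0 surfM _ _ _ (derivable_inP du)) ?mulr0//.
  by move=> y yl; exact: alphaM.
by move=> v; apply: N0; exact: alphaM.
Qed.

Lemma frameg_frameT u t : dot (frameg l N alpha u t) (frameT l alpha u t) = 0.
Proof. exact: dot_cross_r. Qed.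

Lemma frameg_framen u t : dot (frameg l N alpha u t) (framen N alpha u t) = 0.
Proof. exact: dot_cross_l. Qed.

Lemma frameg_unit u t : u \in `[0, l] -> t \in `[0, w[ ->
  dot (frameg l N alpha u t) (frameg l N alpha u t) = 1.
Proof.
move=> ul tw; rewrite dot_cross_cross framen_unit// frameT_unit//.
by rewrite framen_frameT// expr0n/= subr0 mulr1.
Qed.

Lemma flow_dot_frameT u t : u \in `[0, l] -> t \in `[0, w[ ->
  dot (partial_t w alpha u t) (frameT l alpha u t) = f1 u t.
Proof.
move=> ul tw; have [_ _ _ ->] := flow ul tw.
have := (frameT_unit ul tw, framen_frameT ul tw, frameg_frameT u t).
(* The frame vectors become variables, lest the scaling rules unfold [frameT]. *)
move: (frameT l alpha u t) (frameg l N alpha u t) (framen N alpha u t).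
move=> T g n [[TT nT] gT]; rewrite !dotDl !dotZl TT nT gT.
by rewrite !mulr0 !addr0 mulr1.
Qed.

Lemma flow_dot_curvature u t : u \in `[0, l] -> t \in `[0, w[ ->
  dot (partial_t w alpha u t) (partial_s l alpha (frameT l alpha) u t) =
  f2 u t * kg u t + f3 u t * kn u t.
Proof.
move=> ul tw; have [_ _ _ ->] := flow ul tw.
have [-> _ _] := curv ul tw.
have := (frameg_unit ul tw, framen_unit ul tw, framen_frameT ul tw,
  frameg_frameT u t, frameg_framen u t).
move: (frameT l alpha u t) (frameg l N alpha u t) (framen N alpha u t).
move=> T g n [[[[gg nn] nT] gT] gn].
rewrite !dotDl !dotDr !dotZl !dotZr gg nn gn !(dotC T) nT gT (dotC n) gn.
by ring.
Qed.

(** $T = v^{-1}\alpha_u$ is a product of derivable factors because $v > 0$ along the whole curve. *)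
Lemma derivable_frameT u t : u \in `[0, l] -> t \in `[0, w[ ->
  has_derive_in `[0, l] u (fun y => frameT l alpha y t)
    (partial_u l (frameT l alpha) u t).
Proof.
move=> ul tw; have pF := within_itvcc_proper ul.
have [_ du _ _ _] := diff_alpha ul tw.
(* Existence of some limit is enough; its value is left for the rules to fill in. *)
apply: derivable_inP; apply/cvg_ex; eexists.
apply: has_derive_in_scale; last exact: derivable_inP du.
apply: has_derive_in_inv => //.
  by move=> y yl; rewrite gt_eqF//; exact: speed_gt0.
apply: has_derive_in_enorm; last exact: derivable_inP du.
exact: speed_gt0.
Qed.

(** The norm rule gives $v_t = \langle\alpha_{ut},\alpha_u\rangle / v$; the factor $1/v$ turns
    $\alpha_u$ into $T$, and the mixed partials commute. *)
Lemma partial_t_speed u t : u \in `[0, l] -> t \in `[0, w[ ->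
  partial_t w (speed l alpha : R -> R -> R^o) u t =
  dot (partial_u l (partial_t w alpha) u t) (frameT l alpha u t).
Proof.
move=> ul tw; have pF := within_itvco_proper tw.
have [_ _ [dtu _] <- _] := diff_alpha ul tw.
rewrite dotZr mulrC; apply: has_derive_in_val.
apply: has_derive_in_enorm; last exact: derivable_inP dtu.
exact: speed_gt0.
Qed.

Lemma speed_evolution u t : u \in `[0, l] -> t \in `[0, w[ ->
  partial_t w (speed l alpha : R -> R -> R^o) u t =
  speed l alpha u t * (partial_s l alpha (f1 : R -> R -> R^o) u t
    - f2 u t * kg u t - f3 u t * kn u t).
Proof.
move=> ul tw; have pF := within_itvcc_proper ul.
have v0 := speed_gt0 ul tw.
have [_ _ [_ dut] _ _] := diff_alpha ul tw.
(* The product rule applies to $f_1 = \langle\alpha_t, T\rangle$, an identity valid on the whole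
   curve and not only at [u]. *)
have df1 : partial_u l (f1 : R -> R -> R^o) u t =
    dot (partial_u l (partial_t w alpha) u t) (frameT l alpha u t) +
    dot (partial_t w alpha u t) (partial_u l (frameT l alpha) u t).
  apply: has_derive_in_val.
  have := has_derive_in_dot (derivable_inP dut) (derivable_frameT ul tw).
  by apply: eq_has_derive_in => // y yl; exact: flow_dot_frameT.
have := flow_dot_curvature ul tw.
rewrite /partial_s dotZr => curvE.
rewrite partial_t_speed// -addrA -opprD -curvE df1 /GRing.scale/=.
by field; rewrite gt_eqF.
Qed.

(** The positive factor $v$ cancels, leaving a pointwise criterion that covers both special
    cases. *)
Lemma partial_t_speed_eq0 u t : u \in `[0, l] -> t \in `[0, w[ ->
  partial_t w (speed l alpha : R -> R -> R^o) u t = 0 <->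
  partial_s l alpha (f1 : R -> R -> R^o) u t = f2 u t * kg u t + f3 u t * kn u t.
Proof.
move=> ul tw; rewrite speed_evolution// -addrA -opprD.
split=> [/eqP|->]; last by rewrite subrr mulr0.
by rewrite mulf_eq0 gt_eqF ?speed_gt0//= subr_eq0 => /eqP.
Qed.

End darboux.

Theorem corollary3p2 (R : realType)
    (M : set 'rV[R]_3) (N : 'rV[R]_3 -> 'rV[R]_3)
    (l w : R) (alpha : R -> R -> 'rV[R]_3)
    (f1 f2 f3 kg kn tg : R -> R -> R)
    (l_gt0 : 0 < l) (w_gt0 : 0 < w)
    (surfM : regular_surface M)
    (orientM : unit_normal_field M N)
    (alphaM : on_domain l w (fun u t => M (alpha u t)))
    (diff_alpha : differentiable_family l w N alpha)
    (speed_gt0 : on_domain l w (fun u t => 0 < speed l alpha u t))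
    (curv : darboux_curvatures l w N alpha kg kn tg)
    (flow : differentiable_flow l w N alpha f1 f2 f3) :
  (geodesic l w kg ->
     (inextensible l w alpha <->
      on_domain l w (fun u t =>
        partial_s l alpha (f1 : R -> R -> R^o) u t = f3 u t * kn u t))) /\
  (asymptotic_line l w kn ->
     (inextensible l w alpha <->
      on_domain l w (fun u t =>
        partial_s l alpha (f1 : R -> R -> R^o) u t = f2 u t * kg u t))).
Proof.
have iffE u t (ul : u \in `[0, l]) (tw : t \in `[0, w[) :=
  partial_t_speed_eq0 l_gt0 w_gt0 surfM orientM alphaM diff_alpha speed_gt0
    curv flow ul tw.
(* In each case one of the two curvature terms of the criterion vanishes. *)
split=> [kg0|kn0]; split=> H u t ul tw.
- by have /(iffE _ _ ul tw) -> := H _ _ ul tw; rewrite kg0// mulr0 add0r.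
- by apply/(iffE _ _ ul tw); rewrite kg0// mulr0 add0r; exact: H.
- by have /(iffE _ _ ul tw) -> := H _ _ ul tw; rewrite kn0// mulr0 addr0.
- by apply/(iffE _ _ ul tw); rewrite kn0// mulr0 addr0; exact: H.
Qed.
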